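(* Let $A=[a_{n,k}]_{n,k\ge0}$ be an infinite lower triangular real matrix and let $Q$ be an infinite lower triangular real matrix which is a left production matrix of $A$, i.e. $$A=Q\begin{bmatrix} I_1 & \\ & Q\end{bmatrix}\begin{bmatrix} I_2 & \\ & Q\end{bmatrix}\begin{bmatrix} I_3 & \\ & Q\end{bmatrix}\cdots .$$ If $Q$ is totally positive, then: (1) $A$ is totally positive; (2) the reversal $\overleftarrow{A}=[a_{n,n-k}]_{n,k\ge0}$ is totally positive; (3) for each $n\ge0$ the row generating polynomial $\sum_{k=0}^n a_{n,k}x^k$ is real-rooted.
   Context: A finite or infinite matrix is totally positive if all its minors are nonnegative. $I_k$ denotes the $k\times k$ identity matrix, and $\begin{bmatrix} I_k & \\ & Q\end{bmatrix}$ the block-diagonal matrix. The infinite product is well defined: for each $m$, the leading principal $(m+1)\times(m+1)$ submatrix of the product of the first $j$ factors is the same for all $j\ge m+1$ (for lower triangular matrices, leading principal submatrices of a product are products of leading principal submatrices, and the leading $(m+1)\times(m+1)$ block of $\begin{bmatrix} I_k & \\ & Q\end{bmatrix}$ is the identity when $k>m$). When $A$ has nonzero diagonal entries, the unique such $Q$ is $A\begin{bmatrix}1 & \\ & A^{-1}\end{bmatrix}$. In the reversal, $a_{n,n-k}=0$ for $k>n$. A polynomial is real-rooted if it is constant or all of its zeros are real. *)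

(* Defs.v *)
From mathcomp Require Import all_boot all_order all_algebra.
From mathcomp Require Import reals complex.

Set Implicit Arguments.
Unset Strict Implicit.
Unset Printing Implicit Defensive.

Import Order.TTheory GRing.Theory Num.Theory.
Local Open Scope ring_scope.

Definition infmx (R : Type) := nat -> nat -> R.

Definition lower_triangular (R : realType) (A : infmx R) : Prop :=
  forall n k : nat, (n < k)%N -> A n k = 0.

(* A minor is given by p increasing row indices and p increasing column
   indices. *)
Definition totally_positive (R : realType) (A : infmx R) : Prop :=
  forall (p : nat) (r c : 'I_p -> nat),
    {homo r : i j / (i < j)%N} -> {homo c : i j / (i < j)%N} ->
    0 <= \det (\matrix_(i < p, j < p) A (r i) (c j)).

(* The block-diagonal matrix with blocks I_k and Q; it is Q itself for
   k = 0. *)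
Definition diag_id (R : realType) (k : nat) (Q : infmx R) : infmx R :=
  fun n m => if (n < k)%N || (m < k)%N then (n == m)%:R
             else Q (n - k)%N (m - k)%N.

(* The product of infinite matrices, for a lower triangular left factor: the
   entries A n j with j > n vanish, so the sum over j stops at n. *)
Definition ltmul (R : realType) (A B : infmx R) : infmx R :=
  fun n m => \sum_(j < n.+1) A n j * B j m.

(* F 0 * F 1 * ... * F j.-1, the identity matrix for j = 0. *)
Fixpoint partial_prod (R : realType) (F : nat -> infmx R) (j : nat) : infmx R :=
  if j is i.+1 then ltmul (partial_prod F i) (F i)
  else fun n m => (n == m)%:R.

(* Each leading principal submatrix of the partial products is eventually
   equal to that of A. *)
Definition is_infinite_prod (R : realType) (F : nat -> infmx R) (A : infmx R)
    : Prop :=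
  forall m : nat, exists j0 : nat, forall j : nat, (j0 <= j)%N ->
    forall n k : nat, (n <= m)%N -> (k <= m)%N -> partial_prod F j n k = A n k.

Definition left_production_matrix (R : realType) (Q A : infmx R) : Prop :=
  is_infinite_prod (fun i => diag_id i Q) A.

Definition reversal (R : realType) (A : infmx R) : infmx R :=
  fun n k => if (k <= n)%N then A n (n - k)%N else 0.

Definition row_poly (R : realType) (A : infmx R) (n : nat) : {poly R} :=
  \sum_(k < n.+1) A n k *: 'X^k.

(* The first disjunct includes the zero polynomial. *)
Definition real_rooted (R : realType) (p : {poly R}) : Prop :=
  (size p <= 1)%N \/
  forall z : R[i], root (map_poly (real_complex R) p) z -> complex.Im z = 0.

(* Main.v *)
(* Products of totally positive matrices are totally positive (Cauchy-Binet),
   which gives (1). The production identity is the recursion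
   A = Q * diag(1, A).

   For (2), let J_c be the leading block of order c + 1 of Q, reversed in both
   indices, followed by an identity block. The recursion says that the row n of
   the reversal is the first row of J_n * J_(n-1) * ... * J_0. Rows are
   accumulated by alternately adding the row (1, 0, 0, ...) on top and
   multiplying by J_c on the right, and both operations preserve total
   positivity.

   For (3), a truncation of Q is a product of nonnegative lower bidiagonal
   matrices (Neville elimination). Along this factorization the polynomials
   1, x A_0, x A_1, ... are transformed into A_0, A_1, ... by two-term nonnegative
   combinations. At a point z of the upper half-plane, all the intermediate
   values at a given row lie in a sector of angle at most arg z < pi, so that
   no such combination can vanish. *)

Require Import Defs.
From mathcomp Require Import all_boot all_order all_algebra.
From mathcomp Require Import perm.
From mathcomp Require Import zify ring.
From mathcomp Require Import reals complex.

Set Implicit Arguments.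
Unset Strict Implicit.
Unset Printing Implicit Defensive.

Import Order.TTheory GRing.Theory Num.Theory.
Local Open Scope ring_scope.

(** * Cauchy-Binet for nonnegative minors *)

Lemma sorting_perm p (f : 'I_p -> nat) :
  injective f -> exists s : 'S_p, {homo f \o s : i j / (i < j)%N}.
Proof.
move=> f_inj; pose t := [tuple f i | i < p].
have /tuple_permP[s ts] : perm_eq (sort_tuple leq t) t by rewrite perm_sort.
have tE i : tnth (sort_tuple leq t) i = f (s i).
  by rewrite (tnth_nth 0%N) ts -tnth_nth !tnth_mktuple.
exists s => i j ij /=; rewrite -!tE !(tnth_nth 0%N).
apply: (sorted_ltn_nth ltn_trans) => //; rewrite ?inE ?size_tuple //.
rewrite ltn_sorted_uniq_leq sort_uniq (sort_sorted leq_total) andbT.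
by rewrite map_inj_uniq // enum_uniq.
Qed.

Section CauchyBinet.
Context {R : realDomainType} {p N : nat}.
Implicit Types (A : 'M[R]_(p, N)) (B : 'M[R]_(N, p)).

Lemma det_mulmx_sum A B :
  \det (A *m B) = \sum_(f : {ffun 'I_p -> 'I_N})
    (\prod_i A i (f i)) * \det (rowsub f B).
Proof.
rewrite /determinant.
under eq_bigr => s _.
  under eq_bigr do rewrite mxE.
  rewrite bigA_distr_bigA mulr_sumr; over.
rewrite exchange_big; apply: eq_bigr => f _; rewrite mulr_sumr.
apply: eq_bigr => s _; rewrite big_split mulrCA; congr (_ * (_ * _)).
by apply: eq_bigr => i _; rewrite mxE.
Qed.

Lemma det_rowsub_perm (f : 'I_p -> 'I_N) (s : 'S_p) B :
  \det (rowsub (f \o s) B) = (-1) ^+ s * \det (rowsub f B).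
Proof.
rewrite -det_perm -det_mulmx -row_permE; congr (\det _).
by apply/matrixP => i j; rewrite !mxE.
Qed.

Lemma det_colsub_perm (f : 'I_p -> 'I_N) (s : 'S_p) A :
  \det (colsub (f \o s) A) = (-1) ^+ s * \det (colsub f A).
Proof.
rewrite -odd_permV -det_perm mulrC -det_mulmx -[(s^-1)%g]invgK -col_permE invgK.
by congr (\det _); apply/matrixP => i j; rewrite !mxE.
Qed.

(** Substituting [f \o s] for f in [det_mulmx_sum] extracts the sign of s from the minor of B, and
    summing over s assembles the minor of A. As f runs over all maps, not only the increasing ones,
    the Cauchy-Binet sum is counted p! times. *)
Lemma det_mulmx_sum_fact A B :
  \det (A *m B) *+ p`! = \sum_(f : {ffun 'I_p -> 'I_N})
    \det (colsub f A) * \det (rowsub f B).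
Proof.
have -> : \det (A *m B) *+ p`! = \sum_(s : 'S_p) \det (A *m B).
  by rewrite sumr_const card_Sn.
under eq_bigr => s _.
  rewrite det_mulmx_sum (reindex (fun f : {ffun 'I_p -> 'I_N} => [ffun i => f (s i)])).
  under eq_bigr => f _.
    have -> : \det (rowsub [ffun i => f (s i)] B) = (-1) ^+ s * \det (rowsub f B).
      rewrite -det_rowsub_perm; congr (\det _).
      by apply/matrixP => i j; rewrite !mxE ffunE.
    over.
  over.
  exists (fun f : {ffun 'I_p -> 'I_N} => [ffun i => f ((s^-1)%g i)]) => f _;
    by apply/ffunP => i; rewrite !ffunE ?permK ?permKV.
rewrite exchange_big; apply: eq_bigr => f _ /=.
rewrite -det_tr /(\det (colsub f A)^T) mulr_suml; apply: eq_bigr => s _.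
rewrite mulrCA mulrA; congr (_ * _ * _); apply: eq_bigr => i _.
by rewrite !mxE ffunE.
Qed.

(** A noninjective f repeats a row of B and contributes 0. Otherwise sorting f multiplies both
    minors by the same sign, so their product is that of two minors with increasing indices. *)
Lemma det_mulmx_ge0 A B :
  (forall f : 'I_p -> 'I_N, {homo f : i j / (i < j)%N} ->
     0 <= \det (colsub f A)) ->
  (forall f : 'I_p -> 'I_N, {homo f : i j / (i < j)%N} ->
     0 <= \det (rowsub f B)) ->
  0 <= \det (A *m B).
Proof.
move=> A_ge0 B_ge0; rewrite -(pmulrn_lge0 _ (fact_gt0 p)) det_mulmx_sum_fact.
apply: sumr_ge0 => f _.
have [f_inj|/injectivePn[i [j ij fij]]] := boolP (injectiveb f); last first.
  have -> : \det (rowsub f B) = 0.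
    by apply: (determinant_alternate ij) => k; rewrite !mxE fij.
  by rewrite mulr0.
have [s fs_homo] := @sorting_perm _ (fun i => f i : nat)
  (inj_comp val_inj (injectiveP _ f_inj)).
have := mulr_ge0 (A_ge0 (f \o s) fs_homo) (B_ge0 (f \o s) fs_homo).
by rewrite det_rowsub_perm det_colsub_perm mulrACA -expr2 sqrr_sign mul1r.
Qed.
End CauchyBinet.

Lemma big_ord_trunc (V : nmodType) n N (F : nat -> V) :
  (n <= N)%N -> (forall j, (n <= j)%N -> F j = 0) ->
  \sum_(j < N) F j = \sum_(j < n) F j.
Proof.
move=> nN F0; rewrite (big_ord_widen _ F nN) [LHS](bigID (fun j : 'I_N => (j < n)%N)) /=.
by rewrite [X in _ + X]big1 ?addr0 // => j; rewrite -leqNgt => /F0.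
Qed.

(** * Closure properties of total positivity *)

Section TotallyPositive.
Context {R : realType}.
Implicit Types A B Q V : infmx R.

Lemma eq_totally_positive A B :
  (forall n m, A n m = B n m) -> totally_positive A -> totally_positive B.
Proof.
move=> AB A_tp p r c r_homo c_homo; have := A_tp p r c r_homo c_homo.
by congr (0 <= \det _); apply/matrixP => i j; rewrite !mxE.
Qed.

Lemma tp_ge0 A n m : totally_positive A -> 0 <= A n m.
Proof.
move=> /(_ 1%N (fun=> n) (fun=> m)); rewrite det_mx11 mxE; apply.
  by move=> i j; rewrite !ord1 ltnn.
by move=> i j; rewrite !ord1 ltnn.
Qed.

Lemma homo_pair (a b : nat) : (a < b)%N ->
  {homo (fun i : 'I_2 => if val i == 0%N then a else b) : i j / (i < j)%N}.
Proof. by move=> ab [[|[]]] // ? [[|[]]] // ? /=. Qed.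

Lemma tp_minor2 A (n n' m m' : nat) :
  totally_positive A -> (n < n')%N -> (m < m')%N ->
  A n m' * A n' m <= A n m * A n' m'.
Proof.
move=> /(_ 2 _ _ (homo_pair _) (homo_pair _)) A_tp nn' mm'.
have := A_tp _ _ _ _ nn' mm'.
rewrite (expand_det_row _ ord0) !big_ord_recl big_ord0 /cofactor !det_mx11 !mxE /=.
by rewrite addr0 expr0 expr1 mul1r mulN1r mulrN subr_ge0.
Qed.

Lemma tp_rows (phi : nat -> nat) A :
  {homo phi : i j / (i <= j)%N} -> totally_positive A ->
  totally_positive (fun n m => A (phi n) m).
Proof.
move=> phi_homo A_tp p r c r_homo c_homo.
have [/injectiveP phir_inj|] := boolP (injectiveb (fun i => phi (r i))).
  apply: A_tp => // i j ij; rewrite ltn_neqAle phi_homo ?andbT; last first.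
    exact/ltnW/r_homo.
  by apply: contraTneq ij => /phir_inj ->; rewrite ltnn.
case/injectivePn => i [j ij rij].
by rewrite (determinant_alternate ij) // => k; rewrite !mxE rij.
Qed.

Lemma tp_shift A : totally_positive A -> totally_positive (fun n m => A n.+1 m.+1).
Proof.
move=> A_tp p r c r_homo c_homo.
by apply: A_tp => i j ij; rewrite ltnS; [apply: r_homo | apply: c_homo].
Qed.

Lemma tp_cut N A :
  totally_positive A -> totally_positive (fun n m => if (n < N)%N then A n m else 0).
Proof.
move=> A_tp p r c r_homo c_homo.
have [/forallP rN|] := boolP [forall i, (r i < N)%N].
  have := A_tp p r c r_homo c_homo; congr (0 <= \det _).
  by apply/matrixP => i j; rewrite !mxE rN.
case/forallPn => i /negbTE riN; rewrite (expand_det_row _ i) big1 // => j _.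
by rewrite !mxE riN mul0r.
Qed.

Definition mulb (N : nat) A B : infmx R :=
  fun n m => \sum_(j < N) A n j * B j m.

Lemma tp_mulb N A B :
  totally_positive A -> totally_positive B -> totally_positive (mulb N A B).
Proof.
move=> A_tp B_tp p r c r_homo c_homo.
have -> : \matrix_(i < p, j < p) mulb N A B (r i) (c j) =
    (\matrix_(i < p, k < N) A (r i) k) *m (\matrix_(k < N, j < p) B k (c j)).
  by apply/matrixP => i j; rewrite !mxE; apply: eq_bigr => k _; rewrite !mxE.
apply: det_mulmx_ge0 => f f_homo.
  have := A_tp p r f r_homo f_homo; congr (0 <= \det _).
  by apply/matrixP => i j; rewrite !mxE.
have := B_tp p f c f_homo c_homo; congr (0 <= \det _).
by apply/matrixP => i j; rewrite !mxE.
Qed.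

Definition border V : infmx R :=
  fun n m => if n is n'.+1 then V n' m else (m == 0%N)%:R.

(** A minor using the new row is expanded along it: only column 0 can contribute, it can only come
    first, and its cofactor is a minor of V. *)
Lemma tp_border V : totally_positive V -> totally_positive (border V).
Proof.
move=> V_tp [|p] r c r_homo c_homo; first by rewrite det_mx00.
have pos (h : 'I_p.+1 -> nat) : {homo h : i j / (i < j)%N} ->
    forall i, (0 < h (lift ord0 i))%N.
  by move=> h_homo i; apply: leq_ltn_trans (h_homo ord0 _ _).
case r0: (r ord0) => [|r0'].
  rewrite (expand_det_row _ ord0) big_ord_recl big1 => [|j _]; last first.
    by rewrite mxE r0 /= gtn_eqF ?mul0r //; apply: pos.
  rewrite addr0 mxE r0 /= mulr_ge0 ?ler0n // /cofactor expr0 mul1r.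
  have := V_tp p (fun i => (r (lift ord0 i)).-1) (fun i => c (lift ord0 i)).
  rewrite (_ : (\matrix_(i, j) _) =
      row' ord0 (col' ord0 (\matrix_(i, j) border V (r i) (c j)))).
    apply; last by move=> i j ij; apply: c_homo.
    move=> i j ij; have := r_homo (lift ord0 i) (lift ord0 j) ij.
    by have := pos r r_homo i; lia.
  apply/matrixP => i j; rewrite !mxE.
  by have := pos r r_homo i; case: (r _).
have rpos i : (0 < r i)%N.
  have [->|i0] := eqVneq i ord0; first by rewrite r0.
  by apply: leq_ltn_trans (r_homo ord0 i _) => //; rewrite lt0n.
have := V_tp p.+1 (fun i => (r i).-1) c.
rewrite (_ : (\matrix_(i, j) _) = \matrix_(i, j) border V (r i) (c j)).
  apply => // i j ij; have := r_homo _ _ ij; have := rpos i; lia.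
by apply/matrixP => i j; rewrite !mxE; have := rpos i; case: (r i).
Qed.

Lemma tp_zero_col A :
  totally_positive A ->
  totally_positive (fun n m => if m is m'.+1 then A n m' else 0).
Proof.
move=> A_tp p r c r_homo c_homo.
have [/forallP c_pos|/forallPn[j]] := boolP [forall j, (0 < c j)%N]; last first.
  rewrite lt0n negbK => /eqP cj; rewrite (expand_det_col _ j) big1 // => i _.
  by rewrite !mxE cj mul0r.
have := A_tp p r (fun i => (c i).-1) r_homo.
rewrite (_ : (\matrix_(i, j) _) =
    \matrix_(i, j) (if c j is m'.+1 then A (r i) m' else 0)).
  apply => // i j ij; have := c_homo _ _ ij; have := c_pos i; lia.
by apply/matrixP => i j; rewrite !mxE; have := c_pos j; case: (c j).
Qed.

Lemma diag_id1E A n m :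
  diag_id 1 A n m = border (fun n m => if m is m'.+1 then A n m' else 0) n m.
Proof. by case: n m => [|n] [|m] //=; rewrite /diag_id /= !subn1. Qed.

Lemma diag_idS k A n m : diag_id k.+1 A n m = diag_id 1 (diag_id k A) n m.
Proof. by case: n m => [|n] [|m]; rewrite /diag_id //= ?orbT // ?subn1 !ltnS. Qed.

Lemma tp_diag_id k A : totally_positive A -> totally_positive (diag_id k A).
Proof.
move=> A_tp; elim: k => [|k IHk].
  by apply: eq_totally_positive A_tp => n m; rewrite /diag_id /= !subn0.
have /tp_zero_col/tp_border := IHk; apply: eq_totally_positive => n m.
by rewrite diag_idS diag_id1E.
Qed.

(** On finitely many rows the identity agrees with diag(I_N, 0). *)
Lemma tp_id : totally_positive (fun n m => (n == m)%:R : R).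
Proof.
move=> p r c r_homo c_homo.
pose N := \max_i (r i).+1; have rN i : (r i < N)%N.
  by rewrite -ltnS; apply: (leq_bigmax (F := fun i => (r i).+1)).
have := @tp_diag_id N (fun _ _ => 0) _ p r c r_homo c_homo.
rewrite (_ : (\matrix_(i, j) _) = \matrix_(i, j) (r i == c j)%:R).
  apply => q r' c' _ _; case: q r' c' => [|q] r' c'; first by rewrite det_mx00.
  rewrite (expand_det_row _ ord0) big1 // => j _.
  by rewrite !mxE mul0r.
by apply/matrixP => i j; rewrite !mxE /diag_id rN.
Qed.

Lemma lt_diag_id k A : lower_triangular A -> lower_triangular (diag_id k A).
Proof.
move=> A_lt n m nm; rewrite /diag_id; case: ifP => [_|/negbT].
  by rewrite (ltn_eqF nm).
by move=> nk; rewrite A_lt //; lia.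
Qed.

Lemma lt_ltmul A B :
  lower_triangular A -> lower_triangular B -> lower_triangular (ltmul A B).
Proof.
move=> A_lt B_lt n m nm; rewrite /ltmul big1 // => j _.
by rewrite B_lt ?mulr0 //; have := ltn_ord j; lia.
Qed.

Lemma ltmulE N A B n m :
  lower_triangular A -> (n < N)%N -> ltmul A B n m = mulb N A B n m.
Proof.
move=> A_lt nN; rewrite /mulb (@big_ord_trunc _ n.+1 N (fun j => A n j * B j m)) // => j nj.
by rewrite A_lt ?mul0r.
Qed.

Lemma tp_ltmul A B :
  lower_triangular A -> totally_positive A -> totally_positive B ->
  totally_positive (ltmul A B).
Proof.
move=> A_lt A_tp B_tp p r c r_homo c_homo.
pose N := \max_i (r i).+1; have rN i : (r i < N)%N.
  by rewrite -ltnS; apply: (leq_bigmax (F := fun i => (r i).+1)).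
have -> : (\matrix_(i, j) ltmul A B (r i) (c j)) =
    \matrix_(i, j) mulb N A B (r i) (c j).
  by apply/matrixP => i j; rewrite !mxE (ltmulE _ _ A_lt (rN i)).
exact: tp_mulb.
Qed.

Lemma ltmulA A B C n m :
  lower_triangular B ->
  ltmul (ltmul A B) C n m = ltmul A (ltmul B C) n m.
Proof.
move=> B_lt; rewrite /ltmul.
under eq_bigr do rewrite mulr_suml.
rewrite exchange_big; apply: eq_bigr => i _ /=; rewrite mulr_sumr.
under eq_bigr do rewrite -mulrA.
rewrite (@big_ord_trunc _ i.+1 n.+1 (fun j => A n i * (B i j * C j m))) // => j ij.
by rewrite B_lt ?mul0r ?mulr0.
Qed.

Lemma ltmul_diag_id1 A B n m :
  ltmul (diag_id 1 A) (diag_id 1 B) n m = diag_id 1 (ltmul A B) n m.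
Proof.
rewrite /ltmul big_ord_recl /= !diag_id1E.
case: n => [|n] /=; first by rewrite big_ord0 addr0 mul1r; case: m.
rewrite mul0r add0r; case: m => [|m] /=.
  by rewrite big1 // => j _; rewrite !diag_id1E /= mulr0.
by apply: eq_bigr => j _; rewrite !diag_id1E.
Qed.

Lemma eq_ltmul A1 A2 B1 B2 n m :
  (forall i j, A1 i j = A2 i j) -> (forall i j, B1 i j = B2 i j) ->
  ltmul A1 B1 n m = ltmul A2 B2 n m.
Proof. by move=> A12 B12; apply: eq_bigr => j _; rewrite A12 B12. Qed.

Lemma ltmul_idr Q n m :
  lower_triangular Q -> ltmul Q (fun i j => (i == j)%:R) n m = Q n m.
Proof.
move=> Q_lt; have [nm|mn] := ltnP n m.
  rewrite Q_lt // /ltmul big1 // => j _.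
  by rewrite ltn_eqF ?mulr0 //; have := ltn_ord j; lia.
rewrite /ltmul (bigD1 (Ordinal (mn : (m < n.+1)%N))) //= eqxx mulr1.
rewrite big1 ?addr0 // => j; rewrite -val_eqE /= => /negbTE ->.
by rewrite mulr0.
Qed.

Lemma ltmul_idl Q n m : ltmul (fun i j => (i == j)%:R) Q n m = Q n m.
Proof.
rewrite /ltmul (bigD1 ord_max) //= eqxx mul1r big1 ?addr0 // => j.
by rewrite -val_eqE eq_sym /= => /negbTE ->; rewrite mul0r.
Qed.

(** * The production recursion and claim (1) *)

Section LeftProductionMatrix.
Variables (A Q : infmx R).
Hypothesis Q_lt : lower_triangular Q.

Lemma lt_partial_prod j : lower_triangular (partial_prod (fun i => diag_id i Q) j).
Proof.
elim: j => [|j IHj]; first by move=> n m nm /=; rewrite (ltn_eqF nm).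
exact/lt_ltmul/lt_diag_id.
Qed.

Lemma tp_partial_prod j :
  totally_positive Q -> totally_positive (partial_prod (fun i => diag_id i Q) j).
Proof.
move=> Q_tp; elim: j => [|j IHj]; first exact: tp_id.
by apply: tp_ltmul; [apply: lt_partial_prod| |apply: tp_diag_id].
Qed.

(** [partial_prod] grows on the right; here the first factor Q is split off on the left, and the
    other factors form diag(1, P) with P the product of j factors. *)
Lemma partial_prodS j n m :
  partial_prod (fun i => diag_id i Q) j.+1 n m =
  ltmul Q (diag_id 1 (partial_prod (fun i => diag_id i Q) j)) n m.
Proof.
elim: j n m => [|j IHj] n m.
  rewrite /= ltmul_idl /diag_id /= !subn0 -[LHS](ltmul_idr n m Q_lt).
  by apply: eq_ltmul => // -[|i] [|k]; rewrite //= !subn1.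
transitivity (ltmul (ltmul Q (diag_id 1 (partial_prod (fun i => diag_id i Q) j)))
                    (diag_id 1 (diag_id j Q)) n m).
  by apply: eq_ltmul => // i k; rewrite diag_idS.
rewrite ltmulA; last exact/lt_diag_id/lt_partial_prod.
by apply: eq_ltmul => // i k; rewrite ltmul_diag_id1.
Qed.

Hypothesis QA : left_production_matrix Q A.

(** The products of [j0] and of [j0.+1] factors both agree with A on the entries involved, so
    [partial_prodS] passes to the limit. *)
Lemma left_production_rec n k : A n k = ltmul Q (diag_id 1 A) n k.
Proof.
have [j0 j0P] := QA (maxn n k).
rewrite -(j0P j0.+1) ?leq_maxl ?leq_maxr // partial_prodS /ltmul.
apply: eq_bigr => i _; congr (_ * _); rewrite !diag_id1E.
case: (val i) (ltn_ord i) k j0P => [|i'] //= i'n [|k] //= j0P.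
by rewrite j0P //; lia.
Qed.

Lemma left_production_rec0 n : A n 0 = Q n 0.
Proof.
rewrite left_production_rec /ltmul big_ord_recl big1 ?addr0 => [|i _].
  by rewrite diag_id1E mulr1.
by rewrite diag_id1E mulr0.
Qed.

Lemma left_production_recS n k : A n k.+1 = \sum_(i < n) Q n i.+1 * A i k.
Proof.
rewrite left_production_rec /ltmul big_ord_recl diag_id1E mulr0 add0r.
by apply: eq_bigr => i _; rewrite diag_id1E.
Qed.

(** A minor involves finitely many indices, hence is a minor of a long enough partial product. *)
Lemma tp_left_production : totally_positive Q -> totally_positive A.
Proof.
move=> Q_tp p r c r_homo c_homo.
pose M := maxn (\max_i r i) (\max_i c i).
have [j0 j0P] := QA M.
have := @tp_partial_prod j0 Q_tp p r c r_homo c_homo.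
congr (0 <= \det _); apply/matrixP => i j; rewrite !mxE j0P // /M leq_max.
  by rewrite (leq_bigmax (F := r)).
by rewrite (leq_bigmax (F := c)) orbT.
Qed.
End LeftProductionMatrix.
End TotallyPositive.

Section Reversal.
Context {R : realType}.
Implicit Types A Q V : infmx R.

(** Reversing the order of both rows and columns multiplies a minor twice by the same sign.
    Truncated subtraction may identify indices from M on; such a minor has a repeated row or column
    and vanishes. *)
Lemma tp_reflect M A :
  totally_positive A -> totally_positive (fun n m => A (M - n)%N (M - m)%N).
Proof.
move=> A_tp p r c r_homo c_homo.
pose s : 'S_p := perm (@rev_ord_inj p).
have refl_homo (h : 'I_p -> nat) : {homo h : i j / (i < j)%N} ->
    injectiveb (fun i => M - h i)%N ->
    {homo (fun i => M - h (s i))%N : i j / (i < j)%N}.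
  move=> h_homo /injectiveP h_inj i j ij; rewrite ltn_neqAle.
  have sji : (s j < s i)%N by rewrite !permE /=; have := ltn_ord j; lia.
  rewrite leq_sub2l ?(ltnW (h_homo _ _ sji)) // andbT.
  by apply: contraTneq sji => /h_inj ->; rewrite ltnn.
have [r_inj|/injectivePn[i [j ij rij]]] := boolP (injectiveb (fun i => M - r i)%N);
  last by rewrite (determinant_alternate ij) // => k; rewrite !mxE rij.
have [c_inj|/injectivePn[i [j ij cij]]] := boolP (injectiveb (fun i => M - c i)%N);
  last by rewrite -det_tr (determinant_alternate ij) // => k; rewrite !mxE cij.
have := A_tp p _ _ (refl_homo r r_homo r_inj) (refl_homo c c_homo c_inj).
pose C := \matrix_(i, j) A (M - r i)%N (M - c j)%N.
rewrite (_ : \matrix_(i, j) _ = rowsub (id \o s) (colsub (id \o s) C)); last first.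
  by apply/matrixP => i j; rewrite !mxE.
rewrite det_rowsub_perm (_ : rowsub id _ = colsub (id \o s) C); last first.
  by apply/matrixP => i j; rewrite !mxE.
rewrite det_colsub_perm (_ : colsub id C = C); last first.
  by apply/matrixP => i j; rewrite !mxE.
by rewrite mulrA -expr2 sqrr_sign mul1r.
Qed.

Section ReversalProduct.
Variables (A Q : infmx R) (M : nat).
Hypotheses (A_lt : lower_triangular A) (Q_lt : lower_triangular Q).
Hypothesis QA : left_production_matrix Q A.

(** On indices at most M this is J_c, of order M + 1. Written as a reflection of diag(I_(M - c), Q),
    it is visibly totally positive. *)
Definition rev_block c : infmx R :=
  fun p q => diag_id (M - c) Q (M - p)%N (M - q)%N.

Fixpoint rev_prod c : infmx R :=
  if c is d.+1 then mulb M.+1 (rev_block d) (rev_prod d)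
  else fun p q => (p == q)%:R.

(** Multiplication by J_c on the left is the recursion A = Q diag(1, A) with both indices reversed;
    rows after c are left unchanged. *)
Lemma rev_prodE c p k : (c <= M.+1)%N -> (p <= M)%N ->
  rev_prod c p k =
    if (p < c)%N then (if (p <= k)%N then reversal A (c.-1 - p)%N (k - p)%N else 0)
    else (p == k)%:R.
Proof.
elim: c p k => [|c IHc] p k //= cM pM; rewrite ltnS.
have [pc|cp] := leqP p c; last first.
  rewrite /mulb (bigD1 (Ordinal (pM : (p < M.+1)%N))) //= big1 ?addr0 => [|j jp].
    rewrite /rev_block /diag_id eqxx IHc ?(ltnW cM) //.
    rewrite (_ : (M - p < M - c)%N); last by lia.
    by rewrite mul1r ltnNge (ltnW cp).
  rewrite /rev_block /diag_id (_ : (M - p < M - c)%N) /=; last by lia.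
  rewrite (_ : (_ == _) = false) ?mul0r //; apply: contra_neqF jp => /eqP eq_pj.
  by apply: val_inj => /=; have := ltn_ord j; lia.
(* Substituting j = c - i turns row p of J_c into row c - p of Q, and triangularity of Q ends the
   sum at i = c - p. *)
transitivity (\sum_(i < (c - p).+1) Q (c - p)%N i * rev_prod c (c - i)%N k).
  rewrite /mulb.
  under eq_bigr => j _.
    rewrite (_ : rev_block c p j = (if (j <= c)%N then Q (c - p)%N (c - j)%N else 0)).
      over.
    rewrite /rev_block /diag_id; case: ifP => [/orP jc|/negbT].
      case: leqP => [|cj]; first by have := ltn_ord j; lia.
      by case: eqP => //; have := ltn_ord j; lia.
    rewrite negb_or -!leqNgt => /andP[_ jc].
    rewrite (_ : (j <= c)%N); last by have := ltn_ord j; lia.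
    by congr Q; have := ltn_ord j; lia.
  rewrite (@big_ord_trunc _ c.+1 M.+1
    (fun j => (if (j <= c)%N then Q (c - p)%N (c - j)%N else 0) * rev_prod c j k)) //;
    last by move=> j cj; rewrite leqNgt cj mul0r.
  rewrite (reindex_inj rev_ord_inj) /=.
  under eq_bigr => i _.
    rewrite subSS leq_subr subKn; last by rewrite -ltnS.
    over.
  rewrite (@big_ord_trunc _ (c - p).+1 c.+1
    (fun i => Q (c - p)%N i * rev_prod c (c - i)%N k)) //; first lia.
  by move=> j cpj; rewrite Q_lt ?mul0r.
transitivity (if (k <= c)%N then A (c - p)%N (c - k)%N else 0); last first.
  rewrite /reversal; case: (leqP p k) => pk.
    rewrite (_ : (k - p <= c - p)%N = (k <= c)%N) //; last by lia.
    by case: (leqP k c) => // kc; congr A; lia.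
  by case: leqP => // kc; rewrite A_lt //; lia.
(* The term i = 0 meets row c of [rev_prod c], still a row of the identity, and accounts for column
   0 of A; the other terms give its later columns. *)
rewrite big_ord_recl subn0 IHc // ?(ltnW cM) // ltnn.
under eq_bigr => i _.
  rewrite IHc ?(ltnW cM) //; last by lia.
  have i_lt := ltn_ord i; have -> : lift ord0 i = i.+1 :> nat by [].
  rewrite (_ : (c - i.+1 < c)%N); last by lia.
  rewrite (_ : (if _ then _ else _) = if (k < c)%N then A i (c - k).-1 else 0).
    over.
  rewrite /reversal; case: (leqP (c - i.+1) k) => ik.
    rewrite (_ : (k - (c - i.+1) <= c.-1 - (c - i.+1))%N = (k < c)%N); last by lia.
    by case: (ltnP k c) => // kc; congr A; lia.
  by case: (ltnP k c) => // kc; rewrite A_lt //; lia.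
have [kc|ck|->] := ltngtP k c.
- rewrite mulr0 add0r -[(c - k)%N in RHS]prednK ?subn_gt0 //.
  by rewrite (left_production_recS Q_lt QA).
- by rewrite mulr0 add0r big1 // => i _; rewrite mulr0.
- by rewrite subnn mulr1 big1 ?addr0 ?(left_production_rec0 Q_lt QA) // => i _;
    rewrite mulr0.
Qed.

(** V collects the rows still to be multiplied by [rev_prod c]. The case c + 1 reduces to the case c
    with V replaced by [border V] times J_c: the added unit row selects row 0 of [rev_prod c.+1],
    which is row c of the reversal. *)
Lemma tp_rev_stack c V : totally_positive Q -> (c <= M.+1)%N -> totally_positive V ->
  totally_positive (fun n m => if (n < c)%N then reversal A n m
                               else mulb M.+1 V (rev_prod c) (n - c)%N m).
Proof.
move=> Q_tp; elim: c V => [|c IHc] V cM V_tp.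
  apply: eq_totally_positive (tp_mulb M.+1 V_tp (@tp_id R)) => n m.
  by rewrite ltn0 subn0.
pose V' := mulb M.+1 (border V) (rev_block c).
have V'_tp : totally_positive V'.
  by apply: tp_mulb; [apply: tp_border | apply/tp_reflect/tp_diag_id].
apply: eq_totally_positive (IHc V' (ltnW cM) V'_tp) => n m.
have mulbA i : mulb M.+1 V' (rev_prod c) i m = mulb M.+1 (border V) (rev_prod c.+1) i m.
  rewrite /= /mulb /V' /mulb; under eq_bigr do rewrite mulr_suml.
  rewrite exchange_big; apply: eq_bigr => j _ /=; rewrite mulr_sumr.
  by apply: eq_bigr => k _; rewrite mulrA.
rewrite mulbA ltnS; case: (ltngtP n c) => // [cn|->].
  by rewrite (_ : n - c = (n - c.+1).+1)%N //; lia.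
rewrite subnn {1}/mulb big_ord_recl /= mul1r big1 ?addr0 => [|i _]; last first.
  by rewrite mul0r.
by rewrite -[LHS]/(rev_prod c.+1 0%N m) rev_prodE //= !subn0.
Qed.
End ReversalProduct.

Lemma tp_reversal A Q : lower_triangular A -> lower_triangular Q ->
  left_production_matrix Q A -> totally_positive Q ->
  totally_positive (reversal A).
Proof.
move=> A_lt Q_lt QA Q_tp p r c r_homo c_homo.
pose M := \max_i r i.
have := @tp_rev_stack A Q M A_lt Q_lt QA M.+1 _ Q_tp (leqnn _) (@tp_id R) p r c r_homo c_homo.
congr (0 <= \det _); apply/matrixP => i j; rewrite !mxE ltnS.
by rewrite (leq_bigmax (F := r)).
Qed.
End Reversal.

(** * Relations between minors *)

Section Syzygy.
Context {R : comNzRingType}.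

Lemma expand_det_border p (X : 'M[R]_(p.+1, p)) (a : 'I_p.+1 -> R) :
  \sum_k a k * ((-1) ^+ k * \det (row' k X)) =
  \det (\matrix_(i, v) if unlift ord0 v is Some v' then X i v' else a i).
Proof.
rewrite (expand_det_col _ ord0); apply: eq_bigr => k _.
rewrite mxE unlift_none /cofactor addn0; congr (_ * (_ * \det _)).
by apply/matrixP => i j; rewrite !mxE liftK.
Qed.

(** The sum expands a determinant in which column j of X occurs twice. *)
Lemma minor_syzygy p (X : 'M[R]_(p.+1, p)) j :
  \sum_k X k j * ((-1) ^+ k * \det (row' k X)) = 0.
Proof.
rewrite expand_det_border -det_tr.
apply: (@determinant_alternate _ _ _ ord0 (lift ord0 j)); first exact: neq_lift.
by move=> i; rewrite !mxE unlift_none liftK.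
Qed.

(* [skip3 l] enumerates the indices other than l, l + 1 and l + 2, except at
   position l, which [set_row] fills with an index of choice. *)
Definition set_row p (l : nat) (h : 'I_p -> 'I_p.+2) (k : 'I_p.+2) (u : 'I_p) :=
  if val u == l then k else h u.

Definition skip3 p (l : nat) (u : 'I_p) : 'I_p.+2 :=
  if (u < l)%N then inord u else inord u.+2.

Lemma set_rowE p (l : nat) (k : 'I_p.+2) (i : 'I_p) :
  set_row l (skip3 l) k i =
    (if (i < l)%N then i : nat else if (i == l :> nat) then k : nat else i.+2) :> nat.
Proof.
rewrite /set_row /skip3 /=; have := ltn_ord i.
by case: (ltngtP i l) => // il ip; rewrite inordK; lia.
Qed.

(** Three-term Plücker relation. Since [N k] is linear in row k of X, [minor_syzygy] kills the
    alternating sum over k of [N k] times the minor omitting row k. For k other than l, t, u, row k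
    is repeated in [N k], so three terms remain. *)
Lemma plucker3 p (X : 'M[R]_(p.+2, p.+1)) (j : 'I_p.+1) (l t u : 'I_p.+2) :
  t = l.+1 :> nat -> u = l.+2 :> nat ->
  let N k := \det (\matrix_(i, v) X (set_row l (skip3 l) k i) (lift j v)) in
  \det (row' t X) * N t = \det (row' l X) * N l + \det (row' u X) * N u.
Proof.
move=> tl ul N.
have lp : (l < p)%N by have := ltn_ord u; rewrite ul !ltnS.
pose l' := Ordinal lp.
have NE k : N k = \sum_v X k (lift j v) *
    cofactor (\matrix_(i, v) X (skip3 l i) (lift j v)) l' v.
  rewrite /N (expand_det_row _ l'); apply: eq_bigr => v _.
  rewrite mxE /set_row eqxx; congr (_ * (_ * \det _)).
  apply/matrixP => x y; rewrite !mxE ifF //.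
  by have := neq_lift l' x; rewrite -val_eqE eq_sym => /negbTE.
have N0 k : k != l -> k != t -> k != u -> N k = 0.
  rewrite -!val_eqE /= tl ul => kl kt ku.
  pose i := if (k < l)%N then k : nat else k.-2.
  have ip : (i < p)%N by rewrite /i; have := ltn_ord k; case: (ltnP k l); lia.
  apply: (@determinant_alternate _ _ _ l' (Ordinal ip)).
    rewrite -val_eqE /= /i; case: (ltnP k l); lia.
  move=> v; rewrite !mxE /set_row eqxx ifF /skip3 /=; last by rewrite /i; case: (ltnP k l); lia.
  congr (X _ _); apply: val_inj; rewrite /i; case: (ltnP k l) => kl' /=.
    by rewrite kl' inordK // ltn_ord.
  by rewrite ifF ?inordK; have := ltn_ord k; lia.
have : \sum_k N k * ((-1) ^+ k * \det (row' k X)) = 0.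
  under eq_bigr do rewrite NE mulr_suml.
  rewrite exchange_big big1 //= => v _.
  by under eq_bigr do rewrite mulrAC; rewrite -mulr_suml minor_syzygy mul0r.
have [lt lu tu] : [/\ t != l, u != l & u != t].
  by rewrite -!val_eqE /= tl ul; split; lia.
rewrite (bigD1 l) //= (bigD1 t) //= (bigD1 u) /=; last by rewrite lu.
rewrite big1 => [|k /andP[/andP[kl kt] ku]]; last by rewrite N0 ?mul0r.
rewrite tl ul !exprS; move: ((-1) ^+ l) (sqrr_sign R l) => s ss sum0.
apply/eqP; rewrite -subr_eq0; apply/eqP; rewrite -[LHS]mul1r -ss.
transitivity (- (s * 0) : R); last by rewrite mulr0 oppr0.
by rewrite -sum0; ring.
Qed.
End Syzygy.

(** * Whitney's inequality *)

Section Whitney.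
Context {R : realType}.
Implicit Types M : infmx R.

Definition minor_mx M p q (r : 'I_p -> nat) (c : 'I_q -> nat) : 'M[R]_(p, q) :=
  \matrix_(i, j) M (r i) (c j).

Lemma row'_minor_mx M p q (r : 'I_p -> nat) (c : 'I_q -> nat) k :
  row' k (minor_mx M r c) = minor_mx M (r \o lift k) c.
Proof. by apply/matrixP => i j; rewrite !mxE. Qed.

Lemma homo_lift p (r : 'I_p.+1 -> nat) k :
  {homo r : i j / (i < j)%N} -> {homo r \o lift k : i j / (i < j)%N}.
Proof. by move=> r_homo i j /= ij; apply: r_homo; rewrite /= /bump; lia. Qed.

(** This keeps minors nonnegative when row [t2] is reduced by row [t1] to clear column 0. Induction
    on t: for t = 0 the difference of the two sides is 0 or a minor bordered by column 0; for larger
    t the Plücker relation removes the row just above [t1] and one column. *)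
Lemma whitney_ineq M t p (r : 'I_p.+1 -> nat) (c : 'I_p -> nat) (t1 t2 : 'I_p.+1) :
  totally_positive M ->
  {homo r : i j / (i < j)%N} -> {homo c : i j / (i < j)%N} ->
  t1 = t :> nat -> t2 = t.+1 :> nat ->
  (forall k : 'I_p.+1, (t2 < k)%N -> M (r k) 0%N = 0) ->
  M (r t2) 0%N * \det (row' t2 (minor_mx M r c)) <=
  M (r t1) 0%N * \det (row' t1 (minor_mx M r c)).
Proof.
move=> M_tp; elim: t p r c t1 t2 => [|t IHt] p r c t1 t2 r_homo c_homo t1E t2E M0.
  have [j|c_pos] := pickP (fun j => c j == 0%N).
    (* The first column repeats column 0, so the syzygy holds with equality. *)
    move=> /eqP cj0; have := minor_syzygy (minor_mx M r c) j.
    rewrite (bigD1 t1) //= (bigD1 t2) /=; last by rewrite -val_eqE /= t1E t2E.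
    rewrite big1 => [|k /andP[]]; rewrite ?mxE ?cj0 ?t1E ?t2E.
      by rewrite addr0 !mul1r expr1 mulN1r mulrN => /eqP; rewrite subr_eq0 => /eqP ->.
    rewrite -!val_eqE /= t1E t2E => k0 k1.
    by rewrite M0 ?mul0r // t2E; lia.
  (* Prepending column 0 keeps the columns increasing, and the expansion along it has only the terms
     of [t1] and [t2]. *)
  have := expand_det_border (minor_mx M r c) (fun k => M (r k) 0%N).
  rewrite (bigD1 t1) //= (bigD1 t2) /=; last by rewrite -val_eqE /= t1E t2E.
  rewrite big1 => [|k /andP[]]; last first.
    rewrite -!val_eqE /= t1E t2E => k0 k1.
    by rewrite M0 ?mul0r // t2E; lia.
  rewrite t1E t2E addr0 expr0 expr1 mul1r mulN1r mulrN => detE.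
  rewrite -subr_ge0 detE.
  pose c' (v : 'I_p.+1) := if unlift ord0 v is Some v' then c v' else 0%N.
  have c'_homo : {homo c' : i j / (i < j)%N}.
    move=> i j; rewrite /c'; case: unliftP => [i'|] ->; case: unliftP => [j'|] -> //.
      by rewrite !lift0 ltnS; apply: c_homo.
    by rewrite lt0n c_pos.
  have := M_tp _ r c' r_homo c'_homo; congr (0 <= \det _).
  by apply/matrixP => i j; rewrite !mxE /c'; case: unliftP => // v _; rewrite mxE.
case: p => [|p] in r c t1 t2 r_homo c_homo t1E t2E M0 *.
  by have := ltn_ord t2; rewrite t2E.
have tp : (t < p.+1)%N by have := ltn_ord t2; rewrite t2E; lia.
have minor_ge0 q (f : 'I_q -> nat) (g : 'I_q -> nat) :
    {homo f : i j / (i < j)%N} -> {homo g : i j / (i < j)%N} ->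
    0 <= \det (minor_mx M f g).
  exact: M_tp.
have d1_ge0 : 0 <= \det (row' t1 (minor_mx M r c)).
  by rewrite row'_minor_mx minor_ge0 //; apply: homo_lift.
have d2_ge0 : 0 <= \det (row' t2 (minor_mx M r c)).
  by rewrite row'_minor_mx minor_ge0 //; apply: homo_lift.
have M_ge0 n : 0 <= M n 0%N by apply: tp_ge0.
have [d20|d2_neq0] := eqVneq (\det (row' t2 (minor_mx M r c))) 0.
  by rewrite d20 mulr0 mulr_ge0.
pose l : 'I_p.+2 := Ordinal (ltnW (tp : (t.+1 < p.+2)%N)).
pose l' : 'I_p.+1 := Ordinal tp.
pose N j k := \det (\matrix_(i, v) minor_mx M r c (set_row l (skip3 l) k i) (lift j v)).
(* Laplace expansion along row l supplies a nonzero minor of order p. *)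
have [j Nj] : exists j, N j t1 != 0.
  apply/existsP; apply: contraNT d2_neq0 => /existsPn Nj0.
  rewrite (expand_det_row _ l') big1 // => j _.
  have /eqP := negbNE (Nj0 j); rewrite /N /cofactor => Nj0'.
  rewrite (_ : row' l' _ = \matrix_(i, v) minor_mx M r c (set_row l (skip3 l) t1 i)
    (lift j v)) ?Nj0' ?mulr0 //.
  apply/matrixP => /= i v; rewrite !mxE; congr (M (r _) _); apply: val_inj => /=.
  rewrite set_rowE /bump t2E t1E /=.
  by case: (ltngtP i t); lia.
have N_ge0 k : k \in [:: l; t1; t2] -> 0 <= N j k.
  move=> k_in; have k_ge : (t <= k <= t.+2)%N.
    by move: k_in; rewrite !inE => /or3P[] /eqP -> /=; lia.
  have := minor_ge0 p (fun i => r (set_row l (skip3 l) k i)) (c \o lift j).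
  rewrite (_ : minor_mx M (fun i => r _) _ = \matrix_(i, v) minor_mx M r c
    (set_row l (skip3 l) k i) (lift j v)).
    apply; last exact: homo_lift.
    move=> i i' ii'; apply: r_homo; rewrite !set_rowE.
    by rewrite /=; case: (ltngtP i t); case: (ltngtP i' t); lia.
  by apply/matrixP => i v; rewrite !mxE.
have N1_gt0 : 0 < N j t1 by rewrite lt_def Nj N_ge0 // !inE eqxx orbT.
have pl : \det (row' t1 (minor_mx M r c)) * N j t1 =
    \det (row' l (minor_mx M r c)) * N j l +
    \det (row' t2 (minor_mx M r c)) * N j t2.
  exact: (@plucker3 _ _ (minor_mx M r c) j l t1 t2 t1E t2E).
have [t1p t2p] : (t < p.+1)%N /\ (t.+1 < p.+1)%N.
  by have := ltn_ord t2; rewrite t2E; split; lia.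
have l1E : lift l (Ordinal t1p) = t1.
  by apply: val_inj; rewrite /= /bump t1E; lia.
have l2E : lift l (Ordinal t2p) = t2.
  by apply: val_inj; rewrite /= /bump t2E; lia.
have := IHt p (r \o lift l) (c \o lift j) (Ordinal t1p) (Ordinal t2p)
  (homo_lift _ r_homo) (homo_lift _ c_homo) erefl erefl.
rewrite /= l1E l2E.
rewrite (_ : row' (Ordinal t2p) _ = \matrix_(i, v) minor_mx M r c
  (set_row l (skip3 l) t1 i) (lift j v)); last first.
  apply/matrixP => /= i v; rewrite !mxE /=; congr (M (r _) _); apply: val_inj => /=.
  rewrite set_rowE /bump t1E /=.
  by case: (ltngtP i t); lia.
rewrite (_ : row' (Ordinal t1p) _ = \matrix_(i, v) minor_mx M r c
  (set_row l (skip3 l) t2 i) (lift j v)); last first.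
  apply/matrixP => /= i v; rewrite !mxE /=; congr (M (r _) _); apply: val_inj => /=.
  rewrite set_rowE /bump t2E /=.
  by case: (ltngtP i t); lia.
rewrite -!/(N j _) => IH.
have {}IH : M (r t2) 0%N * N j t1 <= M (r t1) 0%N * N j t2.
  apply: IH => k /= tk; apply: M0; rewrite t2E /= /bump; lia.
have Nl_ge0 : 0 <= N j l by rewrite N_ge0 // !inE eqxx.
have dl_ge0 : 0 <= \det (row' l (minor_mx M r c)).
  by rewrite row'_minor_mx minor_ge0 //; apply: homo_lift.
(* Multiply by [N j t1], substitute the Plücker relation, bound the term of l below by 0 and the
   other one by the induction hypothesis. *)
rewrite -(ler_pM2r N1_gt0) -[leRHS]mulrA pl mulrDr.
rewrite -[leLHS]add0r lerD ?mulr_ge0 //.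
by have := ler_wpM2r d2_ge0 IH; congr (_ <= _); ring.
Qed.
End Whitney.

(** * Neville elimination and bidiagonal factorization *)

Section BidiagonalFactorization.
Context {R : realType}.
Implicit Types M Q : infmx R.

Definition neville M i : infmx R :=
  fun n m => if n == i.+1 then M i.+1 m - M i.+1 0%N / M i 0%N * M i m else M n m.

(** By linearity in row i + 1, a minor is that of M minus [lam] times the one with row i in place of
    row i + 1. The latter vanishes if row i is selected too; otherwise [whitney_ineq] applies. *)
Lemma tp_neville M i :
  totally_positive M -> 0 < M i 0%N -> (forall k, (i.+1 < k)%N -> M k 0%N = 0) ->
  totally_positive (neville M i).
Proof.
move=> M_tp Mi0 M0 p r c r_homo c_homo.
have [t /eqP rt|r_neq] := pickP (fun t => r t == i.+1); last first.
  have := M_tp p r c r_homo c_homo; congr (0 <= \det _).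
  by apply/matrixP => k j; rewrite !mxE /neville r_neq.
case: p r c r_homo c_homo t rt => [|p] r c r_homo c_homo t rt; first by case: t rt.
pose r' k := if k == t then i else r k.
have r_neq k : k != t -> (r k == i.+1) = false.
  move=> kt; apply: contra_neqF kt => /eqP rk; apply: val_inj => /=.
  by have [/r_homo|/r_homo|//] := ltngtP k t; rewrite rk rt ltnn.
set lam := M i.+1 0%N / M i 0%N.
have -> : \det (\matrix_(k, j) neville M i (r k) (c j)) =
    1 * \det (minor_mx M r c) + - lam * \det (minor_mx M r' c).
  apply: (determinant_multilinear (i0 := t)).
  - by apply/rowP => j; rewrite !mxE /neville /r' rt !eqxx mul1r mulNr.
  - apply/matrixP => k j; rewrite !mxE /neville r_neq //.
    by rewrite eq_sym neq_lift.
  - apply/matrixP => k j; rewrite !mxE /neville /r' r_neq ?ifF //.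
      by apply: negbTE; rewrite eq_sym neq_lift.
    by rewrite eq_sym neq_lift.
rewrite mul1r mulNr subr_ge0.
have [t' /eqP rt'|r_neqi] := pickP (fun t => r t == i).
  rewrite (_ : \det (minor_mx M r' c) = 0) ?mulr0; first exact: M_tp.
  have t't : t' != t by apply: contra_eq_neq rt' => ->; rewrite rt neq_ltn ltnSn orbT.
  apply: (determinant_alternate t't) => j.
  by rewrite !mxE /r' eqxx (negbTE t't) rt'.
(* The rows r with i inserted just before i + 1: omitting position t + 1 gives [r'], omitting
   position t gives r. *)
pose rho (k : 'I_p.+2) := if (k < t)%N then r (inord k)
  else if k == t :> nat then i else r (inord k.-1).
have t_lt := ltn_ord t.
pose t1 : 'I_p.+2 := inord t; pose t2 : 'I_p.+2 := inord t.+1.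
have t1E : t1 = t :> nat by rewrite inordK // ltnW.
have t2E : t2 = t.+1 :> nat by rewrite inordK.
have r_lt (k : 'I_p.+1) : (k < t)%N -> (r k < i)%N.
  by move=> /r_homo; rewrite rt ltnS leq_eqVlt r_neqi.
have r_gt (k : 'I_p.+1) : (t <= k)%N -> (i < r k)%N.
  rewrite leq_eqVlt => /predU1P[/val_inj <-|/r_homo]; first by rewrite rt.
  by rewrite rt; apply: ltn_trans.
have rho_lt (x : 'I_p.+2) (k : 'I_p.+1) : x = k :> nat -> (k < t)%N -> rho x = r k.
  by move=> xk kt; rewrite /rho xk kt; congr r; apply: val_inj; rewrite /= inordK.
have rho_eq (x : 'I_p.+2) : x = t :> nat -> rho x = i.
  by move=> xt; rewrite /rho xt ltnn eqxx.
have rho_gt (x : 'I_p.+2) (k : 'I_p.+1) :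
    x = k.+1 :> nat -> (t <= k)%N -> rho x = r k.
  move=> xk tk; rewrite /rho xk ltnNge (leqW tk) gtn_eqF //=.
  by congr r; apply: val_inj; rewrite /= inordK.
have rhoP (x : 'I_p.+2) : [\/ (exists2 k : 'I_p.+1, x = k :> nat & (k < t)%N),
    x = t :> nat | (exists2 k : 'I_p.+1, x = k.+1 :> nat & (t <= k)%N)].
  have [xt|tx|] := ltngtP x t; last by constructor 2.
    by constructor 1; exists (inord x); rewrite inordK // (ltn_trans xt t_lt).
  have x_lt := ltn_ord x.
  by constructor 3; exists (inord x.-1); rewrite inordK; lia.
have rho_homo : {homo rho : k l / (k < l)%N}.
  move=> x y; case: (rhoP x) => [[k xk kt]|xt|[k xk kt]];
    case: (rhoP y) => [[l yl lt]|yt|[l yl lt]]; rewrite ?xk ?xt ?yl ?yt => xy;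
    try lia.
  - by rewrite (rho_lt _ _ xk) // (rho_lt _ _ yl) // r_homo.
  - by rewrite (rho_lt _ _ xk) // (rho_eq _ yt) r_lt.
  - by rewrite (rho_lt _ _ xk) // (rho_gt _ _ yl) // (ltn_trans (r_lt _ _)) ?r_gt.
  - by rewrite (rho_eq _ xt) // (rho_gt _ _ yl) // r_gt.
  - by rewrite (rho_gt _ _ xk) // (rho_gt _ _ yl) // r_homo.
have := whitney_ineq M_tp rho_homo c_homo t1E t2E.
rewrite (rho_eq _ t1E) (rho_gt t2 t t2E (leqnn t)) rt !row'_minor_mx.
rewrite (_ : minor_mx M (rho \o lift t2) c = minor_mx M r' c); last first.
  apply/matrixP => /= k j; rewrite !mxE /r' /= -val_eqE /=; congr (M _ _).
  case: ltngtP => kt.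
  - by apply: rho_lt => //; rewrite /= /bump t2E; lia.
  - by apply: rho_gt (ltnW kt); rewrite /= /bump t2E; lia.
  - by apply: rho_eq; rewrite /= /bump t2E; lia.
rewrite (_ : minor_mx M (rho \o lift t1) c = minor_mx M r c); last first.
  apply/matrixP => /= k j; rewrite !mxE /=; congr (M _ _).
  case: (leqP t k) => kt.
    by apply: (rho_gt _ _ _ kt); rewrite /= /bump t1E; lia.
  by apply: (rho_lt _ _ _ kt); rewrite /= /bump t1E; lia.
move=> W; rewrite /lam mulrAC ler_pdivrMr // [leRHS]mulrC; apply: W => x.
rewrite t2E; case: (rhoP x) => [[k -> kt]|->|[k xk tk]]; try lia.
rewrite xk ltnS (rho_gt _ _ xk) // => {}tk; apply: M0; rewrite -rt.
exact: r_homo.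
Qed.

(* In row 0 the subdiagonal weight [b 0] is added to the diagonal one, since
   [0.-1 = 0]. *)
Inductive bidiag_prod : infmx R -> Prop :=
| Bidiag1 Q : (forall n m, Q n m = (n == m)%:R) -> bidiag_prod Q
| BidiagM (c b : nat -> R) Q' Q :
    (forall n, 0 <= c n) -> (forall n, 0 <= b n) -> bidiag_prod Q' ->
    (forall n m, Q n m = c n * Q' n m + b n * Q' n.-1 m) -> bidiag_prod Q.

(** The factors of Q' are shifted down by one row, and d enters through an innermost diagonal
    factor. After the shift, row 1 is preceded by the new row 0 rather than by itself, so the weight
    [b 0] moves into its diagonal weight. *)
Lemma bidiag_prod_block d Q Q' :
  0 <= d -> bidiag_prod Q' ->
  Q 0%N 0%N = d -> (forall m, Q 0%N m.+1 = 0) -> (forall n, Q n.+1 0%N = 0) ->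
  (forall n m, Q n.+1 m.+1 = Q' n m) -> bidiag_prod Q.
Proof.
move=> d0 Q'_prod; elim: Q'_prod Q => {Q'} [Q' Q'E|c b Q'' Q' c0 b0 _ IH Q'E] Q
  Q00 Q0S QS0 QSS.
  apply: (@BidiagM (fun n => if n is 0%N then d else 1) (fun=> 0)
    (fun n m => (n == m)%:R)); [by case|by []|exact: Bidiag1|].
  by move=> [|n] [|m]; rewrite ?Q00 ?Q0S ?QS0 ?QSS ?Q'E /= !(mulr0, mulr1, mul1r, mul0r, addr0).
pose Q1 n m := match n, m with
  | 0%N, 0%N => d | n'.+1, m'.+1 => Q'' n' m' | _, _ => 0 end.
apply: (@BidiagM (fun n => if n is n'.+1 then
                    (if n' is 0%N then c 0%N + b 0%N else c n') else 1)
                 (fun n => if n is n'.+2 then b n'.+1 else 0) Q1).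
- by move=> [|[|n]] //; rewrite addr_ge0.
- by move=> [|[|n]].
- by apply: (IH Q1).
- by move=> [|[|n]] [|m]; rewrite ?Q00 ?Q0S ?QS0 ?QSS ?Q'E /=
    ?(mulr0, mulr1, mul1r, mul0r, addr0) ?mulrDl.
Qed.

(** Nonnegativity of the minor with rows l, k and columns 0, m forces [M l m <= 0] when m > 0. *)
Lemma tp_row0 M l k m :
  totally_positive M -> (l < k)%N -> M l 0%N = 0 -> 0 < M k 0%N -> M l m = 0.
Proof.
move=> M_tp lk Ml0 Mk0; case: m => [//|m].
have := tp_minor2 M_tp lk (ltn0Sn m); rewrite Ml0 mul0r pmulr_lle0 // => Mlm.
by apply/eqP; rewrite eq_le Mlm tp_ge0.
Qed.

Lemma bidiag_prod_diag (c : nat -> R) Q Q' :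
  (forall n, 0 <= c n) -> bidiag_prod Q' -> (forall n m, Q n m = c n * Q' n m) ->
  bidiag_prod Q.
Proof.
move=> c0 Q'_prod QE; apply: (BidiagM (b := fun=> 0) c0 _ Q'_prod) => // n m.
by rewrite mul0r addr0.
Qed.

Section ColumnElimination.
Variable N : nat.
Hypothesis IHN : forall Q, lower_triangular Q -> totally_positive Q ->
  (forall n m, (N <= n)%N -> Q n m = 0) -> bidiag_prod Q.

(** Induction on i, a bound on the last nonzero row of column 0. For i = 0 a 1 by 1 diagonal block
    splits off and [IHN] factors the rest. Otherwise the entry of row i + 1 is cleared using a pivot
    above it. *)
Lemma bidiag_prod_col i Q :
  lower_triangular Q -> totally_positive Q ->
  (forall n m, (N < n)%N -> Q n m = 0) -> (forall k, (i < k)%N -> Q k 0%N = 0) ->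
  bidiag_prod Q.
Proof.
elim: i Q => [|i IHi] Q Q_lt Q_tp QN Qi.
  apply: (bidiag_prod_block (tp_ge0 0 0 Q_tp)
    (IHN (Q := fun n m => Q n.+1 m.+1) _ (tp_shift Q_tp) _)) => //.
  - by move=> n m nm; apply: Q_lt.
  - by move=> n m Nn; apply: QN.
  - by move=> m; apply: Q_lt.
  - by move=> n; apply: Qi.
have [Qi1|] := ltP 0 (Q i.+1 0%N); last first.
  move=> Qi1; apply: IHi => // k; rewrite leq_eqVlt => /predU1P[<-|/Qi //].
  by apply/eqP; rewrite eq_le Qi1 tp_ge0.
have iN : (i.+1 <= N)%N by rewrite leqNgt; apply: contraTN Qi1 => /QN ->; rewrite ltxx.
(* Adjacent pivot: one elimination step, undone by a factor with unit diagonal and a single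
   subdiagonal weight. *)
have step1 M : lower_triangular M -> totally_positive M ->
    (forall n m, (N < n)%N -> M n m = 0) ->
    (forall k, (i.+1 < k)%N -> M k 0%N = 0) -> 0 < M i 0%N -> bidiag_prod M.
  move=> M_lt M_tp MN Mi Mi0.
  apply: (@BidiagM (fun=> 1)
    (fun n => if n == i.+1 then M i.+1 0%N / M i 0%N else 0) (neville M i)) => //.
  - by move=> n; case: ifP => // _; rewrite divr_ge0 ?tp_ge0.
  - apply: IHi.
    + move=> n m nm; rewrite /neville; case: eqP => [ni|_]; last exact: M_lt.
      by rewrite (M_lt i.+1 m) ?(M_lt i m) ?mulr0 ?subr0 //; lia.
    + exact: tp_neville.
    + move=> n m Nn; rewrite /neville ifF ?MN //; lia.
    + move=> k; rewrite leq_eqVlt /neville eq_sym; case: eqP => [_ _|_ /Mi //].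
      by rewrite divfK ?subrr // gt_eqF.
  - move=> n m; rewrite /neville; case: eqP => [->|_]; last by rewrite mul1r mul0r addr0.
    by rewrite /= ltn_eqF // mul1r subrK.
have step2 M r : lower_triangular M -> totally_positive M ->
    (forall n m, (N < n)%N -> M n m = 0) ->
    (forall k, (i.+1 < k)%N -> M k 0%N = 0) -> 0 < M i.+1 0%N ->
    (r <= i)%N -> 0 < M r 0%N -> (forall k, (r < k <= i)%N -> M k 0%N = 0) ->
    bidiag_prod M.
  move=> M_lt M_tp MN Mi Mi1 ri Mr M0.
  (* The rows strictly between r and i + 1 vanish: overwrite them by copies of
     row r, so that the elimination step involves adjacent rows. *)
  pose phi k := if (r < k <= i)%N then r else k.
  apply: (bidiag_prod_diag (c := fun k => if (r < k <= i)%N then 0 else 1)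
    (Q' := fun n m => M (phi n) m)).
  - by move=> n; case: ifP.
  - apply: step1.
    + by move=> n m nm; apply: M_lt; rewrite /phi; case: ifP; lia.
    + by apply: tp_rows => // k l kl; rewrite /phi; case: ifP; case: ifP; lia.
    + by move=> n m Nn; rewrite MN // /phi ifF //; lia.
    + by move=> k ik; rewrite Mi // /phi ifF //; lia.
    + by rewrite /phi leqnn andbT; case: ltnP => // ir; rewrite (_ : i = r) //; lia.
  - move=> n m; rewrite /phi; case: ifP => [nri|_]; last by rewrite mul1r.
    by rewrite mul0r (tp_row0 _ M_tp _ (M0 _ nri) Mi1) // ltnS; case/andP: nri.
have [/existsP[r0 Qr0]|/existsPn no_r] := boolP [exists r : 'I_i.+1, 0 < Q r 0%N].
  have rP : exists r, (r <= i)%N && (0 < Q r 0%N).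
    by exists r0; rewrite -ltnS ltn_ord.
  have r_bd r : (r <= i)%N && (0 < Q r 0%N) -> (r <= i)%N by case/andP.
  case: (ex_maxnP rP r_bd) => r /andP[ri Qr] r_max.
  apply: (step2 Q r) => // k /andP[rk ki].
  apply/eqP; rewrite eq_le tp_ge0 // andbT leNgt; apply: contraTN rk => Qk.
  by rewrite -leqNgt r_max // ki.
have Q0 k : (k <= i)%N -> Q k 0%N = 0.
  move=> ki; apply/eqP; rewrite eq_le tp_ge0 // andbT leNgt.
  exact: (no_r (Ordinal (ki : (k < i.+1)%N))).
(* No pivot exists, and row 0 of Q vanishes by [tp_row0]. The unit row put in its place serves as
   pivot for [step2], and the diagonal factor with weight 0 in row 0 erases it again. *)
apply: (bidiag_prod_diag (c := fun k => if k is 0%N then 0 else 1)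
  (Q' := border (fun n m => Q n.+1 m))).
- by case.
- apply: (step2 _ 0%N) => //.
  + by move=> [|n] [|m] //= nm; apply: Q_lt.
  + by apply: tp_border; apply: tp_rows Q_tp => k l kl; rewrite ltnS.
  + by move=> [|n] m //= Nn; apply: QN.
  + by move=> [|k] //= ik; apply: Qi.
  + by move=> [|k] //= ki; apply: Q0.
- move=> [|n] m; last by rewrite mul1r.
  by rewrite mul0r (tp_row0 _ Q_tp (ltn0Sn i)) // Q0.
Qed.
End ColumnElimination.

Lemma bidiag_prod_tp N Q :
  lower_triangular Q -> totally_positive Q ->
  (forall n m, (N <= n)%N -> Q n m = 0) -> bidiag_prod Q.
Proof.
elim: N Q => [|N IHN] Q Q_lt Q_tp QN.
  apply: (bidiag_prod_diag (c := fun=> 0) _ (Bidiag1 (fun _ _ => erefl))) => // n m.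
  by rewrite QN ?mul0r.
by apply: (bidiag_prod_col (i := N) IHN Q_lt Q_tp QN) => k Nk; apply: QN.
Qed.
End BidiagonalFactorization.

Lemma downward_ind L (P : nat -> Prop) : P L ->
  (forall l, (l < L)%N -> P l.+1 -> P l) -> forall l, (l <= L)%N -> P l.
Proof.
move=> PL Pdown l lL; rewrite -(subKn lL); elim: (L - l)%N (leq_subr l L).
  by rewrite subn0.
move=> d IHd dL; apply: Pdown; first by lia.
by rewrite -subSn // subSS; apply: IHd; lia.
Qed.

Section RealRooted.
Context {R : realType}.
Local Notation C := R[i].
Local Notation Re := (@complex.Re R).
Local Notation Im := (@complex.Im R).
Implicit Types (u v w z : C) (p q : {poly R}).

(* The imaginary part of u^* v: it is nonnegative when the angle from u to v
   lies in [0, pi]. *)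
Definition wedge u v : R := Re u * Im v - Im u * Re v.

Lemma wedge_combr (c b : R) u v w :
  wedge u (c%:C%C * v + b%:C%C * w) = c * wedge u v + b * wedge u w.
Proof. by case: u v w => [? ?] [? ?] [? ?]; rewrite /wedge /=; ring. Qed.

Lemma wedge_combl (c b : R) u v w :
  wedge (c%:C%C * v + b%:C%C * w) u = c * wedge v u + b * wedge w u.
Proof. by case: u v w => [? ?] [? ?] [? ?]; rewrite /wedge /=; ring. Qed.

Lemma wedge_mulr (c b : R) u v w z :
  wedge u (z * (c%:C%C * v + b%:C%C * w)) =
  c * wedge u (z * v) + b * wedge u (z * w).
Proof. by rewrite mulrDr !(mulrCA z) wedge_combr. Qed.

Lemma wedgexx u : wedge u u = 0.
Proof. by rewrite /wedge mulrC subrr. Qed.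

Lemma wedge_mulx u z : wedge u (z * u) = Im z * (Re u ^+ 2 + Im u ^+ 2).
Proof. by case: u z => [? ?] [? ?]; rewrite /wedge /=; ring. Qed.

Lemma wedge_mulxx u v z :
  wedge (z * u) (z * v) = (Re z ^+ 2 + Im z ^+ 2) * wedge u v.
Proof. by case: u v z => [? ?] [? ?] [? ?]; rewrite /wedge /=; ring. Qed.

Lemma sqr_norm_gt0 u : u != 0 -> 0 < Re u ^+ 2 + Im u ^+ 2.
Proof.
move=> u0; rewrite lt_def addr_ge0 ?sqr_ge0 // andbT.
by apply: contra u0; rewrite paddr_eq0 ?sqr_ge0 // !sqrf_eq0 eq_complex.
Qed.

(** If the combination were 0, so would be its wedge c Im z |u|^2 + b [wedge u (z * v)] after
    multiplication by z, whose first term is positive. *)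
Lemma comb_neq0 (c b : R) u v z :
  0 < Im z -> 0 < c -> 0 <= b -> u != 0 -> 0 <= wedge u (z * v) ->
  c%:C%C * u + b%:C%C * v != 0.
Proof.
move=> z0 c0 b0 u0 uv; apply/eqP => comb0.
have := wedge_mulr c b u u v z; rewrite comb0 mulr0 wedge_mulx.
have -> : wedge u 0 = 0 by rewrite /wedge /= !mulr0 subr0.
apply/eqP; rewrite lt_eqF // ltr_wpDr ?mulr_ge0 //.
by rewrite !mulr_gt0 ?sqr_norm_gt0.
Qed.

Definition evalC z p : C := (map_poly (real_complex R) p).[z].

Lemma evalC_comb z (c b : R) p q :
  evalC z (c *: p + b *: q) = c%:C%C * evalC z p + b%:C%C * evalC z q.
Proof. by rewrite /evalC raddfD /= !map_polyZ /= hornerD !hornerZ. Qed.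

Lemma evalCXM z p : evalC z ('X * p) = z * evalC z p.
Proof. by rewrite /evalC rmorphM /= map_polyX hornerM hornerX. Qed.

Section Layers.
(** In the application layer L is 1, x A_0, x A_1, ..., layer 0 is A_0, A_1, ..., and each layer
    arises from the next one by a bidiagonal factor. *)
Variables (L K : nat) (c b : nat -> nat -> R) (F : nat -> nat -> {poly R}).
Hypotheses (c_ge0 : forall l s, 0 <= c l s) (b_ge0 : forall l s, 0 <= b l s).
Hypothesis F_layer : forall l s, (l < L)%N -> (s < K)%N ->
  F l s = c l s *: F l.+1 s + b l s *: F l.+1 s.-1.
Hypothesis F_top0 : F L 0%N = 1.
Hypothesis F_topS : forall s, (s.+1 < K)%N -> F L s.+1 = 'X * F 0%N s.
Variable z : C.
Hypothesis z_gt0 : 0 < Im z.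

Let f l s := evalC z (F l s).

Let z_neq0 : z != 0.
Proof. by apply: contraTneq z_gt0 => ->; rewrite ltxx. Qed.

Let fE l s : (l < L)%N -> (s < K)%N ->
  f l s = (c l s)%:C%C * f l.+1 s + (b l s)%:C%C * f l.+1 s.-1.
Proof. by move=> lL sK; rewrite /f F_layer // evalC_comb. Qed.

Let f_topS s : (s.+1 < K)%N -> f L s.+1 = z * f 0%N s.
Proof. by move=> sK; rewrite /f F_topS // evalCXM. Qed.

(* The values f L s, ..., f 0 s turn clockwise, staying in a sector of angle at
   most arg z. *)
Let sector s := forall l m, (l <= m)%N -> (m <= L)%N ->
  0 <= wedge (f l s) (f m s) /\ 0 <= wedge (f m s) (z * f l s).

Let nonvanishing s := forall l, (l <= L)%N -> F l s = 0 \/ f l s != 0.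

(** As [0.-1 = 0], row 0 of each layer is a nonnegative constant. *)
Let layer0 : (0 < K)%N -> sector 0 /\ nonvanishing 0.
Proof.
move=> K0; have [k k_ge0 Fk] : exists2 k : nat -> R, (forall l, 0 <= k l) &
    forall l, (l <= L)%N -> F l 0%N = (k l)%:P.
  pose k l := if (l <= L)%N then (F l 0%N)`_0 else 0.
  have FP l : (l <= L)%N -> exists2 x, 0 <= x & F l 0%N = x%:P.
    move: l; apply: downward_ind => [|l lL [x x0 Fx]]; first by exists 1; rewrite ?F_top0.
    exists ((c l 0%N + b l 0%N) * x); first by rewrite mulr_ge0 ?addr_ge0.
    by rewrite F_layer //= Fx -scalerDl -mul_polyC polyCM.
  exists k => l; rewrite /k; last by move=> lL; rewrite lL; have [x _ ->] := FP _ lL;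
    rewrite coefC.
  by case: ifP => // lL; have [x x0 ->] := FP _ lL; rewrite coefC.
have fk l : (l <= L)%N -> f l 0%N = (k l)%:C%C.
  by move=> lL; rewrite /f Fk // /evalC map_polyC hornerC.
split=> [l m lm mL|l lL].
  have lL := leq_trans lm mL; rewrite !fk //.
  have wkz : wedge (k m)%:C%C (z * (k l)%:C%C) = Im z * (k m * k l).
    by case: (z) => [? ?]; rewrite /wedge /=; ring.
  by rewrite wkz /wedge /= mulr0 mul0r subrr !mulr_ge0 // ltW.
rewrite Fk // fk //; have [->|kl] := eqVneq (k l) 0; [by left|right].
by rewrite eq_complex /= eqxx andbT.
Qed.

Let layerS s : (s.+1 < K)%N ->
  sector s -> nonvanishing s -> sector s.+1 /\ nonvanishing s.+1.
Proof.
move=> sK sect nv.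
(* For m <= l, [f l s.+1] lies in angle between [f m s] and [z * f m s]. At the top this follows
   from [f L s.+1 = z * f 0 s], and the nonnegative combinations preserve it. *)
have f_prev l : (l <= L)%N -> forall m, (m <= l)%N ->
    0 <= wedge (f m s) (f l s.+1) /\ 0 <= wedge (f l s.+1) (z * f m s).
  move: l; apply: downward_ind => [|l lL IHl] m ml.
    have [_ w1] := sect 0%N m (leq0n m) ml; have [w2 _] := sect 0%N m (leq0n m) ml.
    by rewrite f_topS // wedge_mulxx mulr_ge0 // addr_ge0 ?sqr_ge0.
  have [w1 w2] := IHl m (leqW ml); have [w3 w4] := sect m l.+1 (leqW ml) lL.
  by rewrite (fE lL sK) /= wedge_combr wedge_combl !addr_ge0 ?mulr_ge0.
split=> [l m lm mL|].
  (* Lowering l with m fixed: of the two terms of [f l s.+1], the one in row s + 1 is covered by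
     induction, the one in row s by [f_prev]. *)
  move: {2}(m - l)%N (erefl (m - l)%N) => d.
  elim: d l lm => [|d IHd] l lm ld.
    have -> : l = m by lia.
    by rewrite wedgexx wedge_mulx !mulr_ge0 ?addr_ge0 ?sqr_ge0 // ltW.
  have [||w1 w2] := IHd l.+1; [lia | lia |].
  have [|w3 w4] := f_prev m mL l.+1; first lia.
  have lL : (l < L)%N by lia.
  by rewrite (fE lL sK) /= wedge_combl wedge_mulr !addr_ge0 ?mulr_ge0.
move=> l; move: l; apply: downward_ind => [|l lL IHl].
  have [F0|f0] := nv 0%N (leq0n L); first by left; rewrite F_topS // F0 mulr0.
  by right; rewrite f_topS // mulf_neq0 // z_neq0.
have scale_nv (x : R) p : p = 0 \/ evalC z p != 0 ->
    x *: p = 0 \/ evalC z (x *: p) != 0.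
  case=> [->|p0]; first by left; rewrite scaler0.
  have [->|x0] := eqVneq x 0; first by left; rewrite scale0r.
  right; rewrite -[x *: p]addr0 -(scale0r p) evalC_comb mul0r addr0.
  by rewrite mulf_neq0 // eq_complex /= eqxx andbT.
rewrite /f F_layer //=.
have [->|c0] := eqVneq (c l s.+1) 0.
  by rewrite scale0r add0r; apply: scale_nv; apply: nv.
case: IHl => [->|f1]; first by rewrite scaler0 add0r; apply: scale_nv; apply: nv.
right; rewrite evalC_comb; apply: (comb_neq0 z_gt0) => //; first by rewrite lt_def c0 c_ge0.
by have [] := f_prev l.+1 lL l.+1 (leqnn _).
Qed.

Lemma layer_nonvanishing s l : (s < K)%N -> (l <= L)%N ->
  F l s = 0 \/ evalC z (F l s) != 0.
Proof.
move=> sK; suff [_] : sector s /\ nonvanishing s by apply.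
elim: s sK => [|s IHs] sK; first exact: layer0.
by have [] := IHs (ltnW sK); apply: layerS.
Qed.
End Layers.

(** The layers are the successive partial products applied to v; an additional outer factor becomes
    layer 0 and shifts the others up. *)
Lemma bidiag_prod_layers K (Q : infmx R) (v : nat -> {poly R}) :
  bidiag_prod Q ->
  exists (L : nat) (c b : nat -> nat -> R) (F : nat -> nat -> {poly R}),
    [/\ forall l s, 0 <= c l s, forall l s, 0 <= b l s,
        forall l s, (l < L)%N -> (s < K)%N ->
          F l s = c l s *: F l.+1 s + b l s *: F l.+1 s.-1,
        forall s, (s < K)%N -> F L s = v s &
        forall s, (s < K)%N -> F 0%N s = \sum_(j < K) Q s j *: v j].
Proof.
elim=> {Q} [Q QE|c b Q' Q c_ge0 b_ge0 _ [L [c' [b' [F [c'_ge0 b'_ge0 F_layer F_top F0]]]]] QE].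
  exists 0%N, (fun _ _ => 0), (fun _ _ => 0), (fun _ => v); split=> // s sK.
  rewrite (bigD1 (Ordinal sK)) //= QE eqxx scale1r big1 ?addr0 // => j.
  by rewrite -val_eqE eq_sym QE /= => /negbTE ->; rewrite scale0r.
exists L.+1, (fun l => if l is l'.+1 then c' l' else c),
  (fun l => if l is l'.+1 then b' l' else b),
  (fun l => if l is l'.+1 then F l' else fun s => c s *: F 0%N s + b s *: F 0%N s.-1).
split=> [[|l]|[|l]|[|l] s lL sK|//|s sK] //; first exact: F_layer.
rewrite !F0 ?(leq_ltn_trans (leq_pred s)) // !scaler_sumr -big_split /=.
by apply: eq_bigr => j _; rewrite QE scalerDl !scalerA.
Qed.

Lemma row_poly_rec (A Q : infmx R) n :
  lower_triangular Q -> lower_triangular A -> left_production_matrix Q A ->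
  row_poly A n =
  \sum_(j < n.+1) Q n j *: (if val j is j'.+1 then 'X * row_poly A j' else 1).
Proof.
move=> Q_lt A_lt QA; rewrite /row_poly !big_ord_recl expr0 (left_production_rec0 Q_lt QA).
congr (_ + _) => /=.
under eq_bigr => k _ do rewrite (left_production_recS Q_lt QA) scaler_suml.
rewrite exchange_big; apply: eq_bigr => i _ /=.
rewrite add0n mulr_sumr scaler_sumr.
rewrite (@big_ord_trunc _ i.+1 n (fun k => (Q n i.+1 * A i k) *: 'X^(k.+1))) //; last first.
  by move=> k ik; rewrite A_lt // mulr0 scale0r.
by apply: eq_bigr => k _; rewrite -scalerAr -exprS scalerA.
Qed.

Lemma real_rooted_left_production (A Q : infmx R) n :
  lower_triangular A -> lower_triangular Q -> left_production_matrix Q A ->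
  totally_positive Q -> real_rooted (row_poly A n).
Proof.
move=> A_lt Q_lt QA Q_tp.
(* The factorization is available for finitely many nonzero rows, so Q is cut after row n. *)
pose QN : infmx R := fun k m => if (k < n.+1)%N then Q k m else 0.
have QN_prod : bidiag_prod QN.
  apply: (@bidiag_prod_tp R n.+1).
  - by move=> k m km; rewrite /QN; case: ifP => // _; apply: Q_lt.
  - exact: tp_cut.
  - by move=> k m nk; rewrite /QN ltnNge nk.
pose v s := if s is s'.+1 then 'X * row_poly A s' else 1.
have [L [c [b [F [c_ge0 b_ge0 F_layer F_top F0]]]]] := bidiag_prod_layers n.+1 v QN_prod.
have F0E s : (s < n.+1)%N -> F 0%N s = row_poly A s.
  move=> sn; rewrite F0 // (row_poly_rec _ Q_lt A_lt QA).
  rewrite (@big_ord_trunc _ s.+1 n.+1 (fun j => QN s j *: v j)) // => [|j sj].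
    by apply: eq_bigr => j _; rewrite /QN sn.
  by rewrite /QN sn Q_lt ?scale0r.
have upper z : 0 < Im z -> row_poly A n = 0 \/ evalC z (row_poly A n) != 0.
  move=> z0; rewrite -F0E //.
  apply: (layer_nonvanishing c_ge0 b_ge0 F_layer _ _ z0) => //.
    by rewrite F_top.
  by move=> s sn; rewrite F_top //= F0E // ltnW.
have [->|p0] := eqVneq (row_poly A n) 0; first by left; rewrite size_poly0.
right=> z; rewrite rootE -/(evalC z _) => /eqP pz0; apply/eqP; apply/negPn.
rewrite neq_lt; apply/negP => /orP[z_lt0|z_gt0]; last first.
  by have [p_eq0|] := upper z z_gt0; [rewrite p_eq0 eqxx in p0|rewrite pz0 eqxx].
(* The coefficients are real, so a root in the lower half-plane has its conjugate, also a root, in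
   the upper one. *)
have [||] := upper z^*%C.
- by case: z z_lt0 {pz0} => ? ?; rewrite /= oppr_gt0.
- by move=> p_eq0; rewrite p_eq0 eqxx in p0.
rewrite (_ : evalC _ _ = (evalC z (row_poly A n))^*%C); first by rewrite pz0 conjc0 eqxx.
rewrite /evalC -horner_map -map_poly_comp; congr (_.[_]).
by apply: eq_map_poly => x; rewrite /= oppr0.
Qed.
End RealRooted.

Theorem theorem1p1 (R : realType) (A Q : infmx R)
    (A_lt : lower_triangular A) (Q_lt : lower_triangular Q)
    (QA : left_production_matrix Q A) (Q_tp : totally_positive Q) :
  totally_positive A /\
  totally_positive (reversal A) /\
  (forall n : nat, real_rooted (row_poly A n)).
Proof.
split; first exact: tp_left_production Q_lt QA Q_tp.
split; first exact: tp_reversal A_lt Q_lt QA Q_tp.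
by move=> n; apply: real_rooted_left_production A_lt Q_lt QA Q_tp.
Qed.
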